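(* Let $d=1$, let $\sigma\in\mathbb R$ and let $b\in\mathcal C^2(\mathbb R,\mathbb R)$ have bounded second derivative and be such that there exists $L>0$ with $(x-y)(b(x)-b(y))\leqslant L|x-y|^2$ for all $x,y\in\mathbb R$. Then $\kappa_1(t)=\beta_1(t)$ for all $t\geqslant 0$.
   Context: Consider the SDE $dX_t=b(X_t)\,dt+\sigma\,dB_t$ on $\mathbb R$, with $B$ a standard one-dimensional Brownian motion; $\mathbb E_x$ denotes expectation with $X_0=x$; $\nu P_t$ is the law of $X_t$ when $X_0\sim\nu$. For a solution $X$ of the SDE, $\Phi_t^X$ is defined by $\Phi_t^Xv=V_t$ where $(V_s)_{s\geqslant 0}$ solves $dV_t=b'(X_t)V_t\,dt$, $V_0=v$, and \[\kappa_1(t)=\sup_{x\in\mathbb R,\ v\in\{-1,1\}}\mathbb E_x\left(|\Phi_t^Xv|\right).\] $\mathcal P_1(\mathbb R)$ is the set of probability measures with finite first moment, $\mathcal W_1$ is the $L^1$ Wasserstein distance associated with the Euclidean distance, and \[\beta_1(t)=\sup_{\nu,\mu\in\mathcal P_1(\mathbb R),\ \nu\neq\mu}\frac{\mathcal W_1(\nu P_t,\mu P_t)}{\mathcal W_1(\nu,\mu)}=\sup_{x\neq y}\frac{\mathcal W_1(\delta_xP_t,\delta_yP_t)}{|x-y|}.\] *)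

(* Defs.v *)
From HB Require Import structures.
From mathcomp Require Import all_boot all_order all_algebra.
From mathcomp Require Import all_classical all_reals all_analysis.

Set Implicit Arguments.
Unset Strict Implicit.
Unset Printing Implicit Defensive.

Import Order.TTheory GRing.Theory Num.Theory.
Import numFieldNormedType.Exports.

Local Open Scope classical_set_scope.
Local Open Scope ring_scope.

Section Drift.
Context {R : realType}.

Definition is_C2 (b : R -> R) : Prop :=
  [/\ forall x, derivable b x 1,
      forall x, derivable (derive1 b) x 1 &
      continuous (derive1n 2 b) ].

Definition one_sided_lipschitz (b : R -> R) (L : R) : Prop :=
  forall x y : R, (x - y) * (b x - b y) <= L * `|x - y| ^+ 2.

End Drift.

Section Wasserstein.
Context {R : realType}.
Local Open Scope ereal_scope.

(* "nu belongs to P_1(R)" *)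
Definition finite_first_moment (nu : probability R R) : Prop :=
  \int[nu]_x (`|x|%R)%:E < +oo.

(* MathComp-Analysis measures are functions on all sets, constrained only on
   the measurable ones, so that equality of measures is tested there. *)
Definition same_measure (nu mu : probability R R) : Prop :=
  forall A : set R, measurable A -> nu A = mu A.

Definition coupling (nu mu : probability R R)
    (gamma : probability (R * R)%type R) : Prop :=
  forall A : set R, measurable A ->
    gamma (A `*` setT) = nu A /\ gamma (setT `*` A) = mu A.

Definition W1 (nu mu : probability R R) : \bar R :=
  ereal_inf [set \int[gamma]_z (`|z.1 - z.2|%R)%:E | gamma in coupling nu mu].

End Wasserstein.

Section Process.
Context {d : measure_display} {T : measurableType d} {R : realType}.
Variable P : probability T R.

(* The sigma-algebra generated by the variables Y_u, u \in D. *)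
Definition sigma_of (Y : R -> {RV P >-> R}) (D : set R) : set (set T) :=
  <<s [set E | exists u (A : set R), [/\ D u, measurable A & E = Y u @^-1` A]] >>.

Definition independent_of (Z : T -> R) (G : set (set T)) : Prop :=
  forall (A : set R) (E : set T), measurable A -> G E ->
    P (Z @^-1` A `&` E) = (P (Z @^-1` A) * P E)%E.

(* Processes are indexed by R; only times t >= 0 are constrained.  The second
   argument of normal_prob is a standard deviation. *)
Definition brownian_motion (B : R -> {RV P >-> R}) : Prop :=
  [/\ {ae P, forall w, B 0 w = 0},
      {ae P, forall w, {within `[0, +oo[, continuous (fun t : R => B t w)}},
      (forall s t : R, 0 <= s -> s < t ->
         independent_of (fun w => B t w - B s w) (sigma_of B `[0, s])) &
      (forall s t : R, 0 <= s -> s < t -> forall A : set R, measurable A ->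
         P ((fun w => B t w - B s w) @^-1` A) =
         normal_prob 0 (Num.sqrt (t - s)) A) ].

(* The noise being additive, dX = b(X) dt + sigma dB involves no stochastic
   integral: it is the pathwise integral equation below. *)
Definition sde_solution (b : R -> R) (sigma : R) (B X : R -> {RV P >-> R})
    : Prop :=
  independent_of (X 0) (sigma_of B `[0, +oo[) /\
  {ae P, forall w, {within `[0, +oo[, continuous (fun t : R => X t w)} /\
    forall t : R, 0 <= t ->
      X t w = X 0 w
        + (\int[lebesgue_measure]_(s in `[0%R, t]) b (X s w))%R
        + sigma * B t w }.

Definition starts_from (X : R -> {RV P >-> R}) (nu : probability R R) : Prop :=
  forall A : set R, measurable A -> distribution P (X 0) A = nu A.

(* dV_t = b'(X_t) V_t dt, V_0 = v *)
Definition tangent_solution (b : R -> R) (X : R -> {RV P >-> R}) (v : R)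
    (V : R -> {RV P >-> R}) : Prop :=
  {ae P, forall w, {within `[0, +oo[, continuous (fun t : R => V t w)} /\
    forall t : R, 0 <= t ->
      V t w = v
        + (\int[lebesgue_measure]_(s in `[0%R, t]) (derive1 b (X s w) * V s w))%R }.

Local Open Scope ereal_scope.

(* Phi x v t is Phi_t^X v for the solution X issued from x. *)
Definition kappa1 (Phi : R -> R -> R -> {RV P >-> R}) (t : R) : \bar R :=
  ereal_sup [set r | exists x v : R,
    (v = -1 \/ v = 1)%R /\ r = 'E_P[fun w => `|Phi x v t w|%R]].

(* X nu is the solution with X_0 ~ nu, so distribution P (X nu t) is nu P_t. *)
Definition beta1 (X : probability R R -> R -> {RV P >-> R}) (t : R) : \bar R :=
  ereal_sup [set r | exists nu mu : probability R R,
    [/\ finite_first_moment nu, finite_first_moment mu,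
        ~ same_measure nu mu &
        r = W1 (distribution P (X nu t)) (distribution P (X mu t)) / W1 nu mu]].

End Process.

(* Main.v *)
Require Import Defs.
From HB Require Import structures.
From mathcomp Require Import all_boot all_order all_algebra.
From mathcomp Require Import all_classical all_reals all_analysis.
From mathcomp Require Import measurable_realfun ring lra.

Import Order.TTheory GRing.Theory Num.Theory.
Import numFieldNormedType.Exports.

Local Open Scope classical_set_scope.
Local Open Scope ring_scope.

(** Let two solutions start from [x] and [y] and be driven by the same noise.
Their difference [h] solves [h' = b(X^x) - b(X^y)], an equation from which the
noise has disappeared, and [b(X^x) - b(X^y) = b'(X^y) h + O(h^2)] because [b'']
is bounded.  Since [|h| <= |x - y| e^(L t)], a Gronwall argument compares [h]
with the tangent process: pathwise,
<<
  |X^x_t - X^y_t| = |x - y| |Phi^y_t| e^(+- C |x - y|),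
>>
and the order of the two solutions is preserved
([path_difference_tangent], [path_order]).

The inequality [beta1 <= kappa1].  Cutting the segment from [y] to [x] into
short pieces and summing the local estimates gives
[E|X^x_t - X^y_t| <= kappa1(t) |x - y|] without ever differentiating the flow
([expected_difference_lipschitz]).  For general initial laws, a coupling of
[nu] and [mu] is transported by the flow, driven by one independent copy of the
noise, to a coupling of [nu P_t] and [mu P_t] whose cost is at most [kappa1(t)]
times the initial one ([W1_flow_ratio]).  This requires that every solution be a
single measurable function of its initial value and of the noise; the limit of
the explicit Euler scheme is such a function, since along each fixed path the
scheme converges to the solution ([euler_cvg], [solution_law]).

The inequality [kappa1 <= beta1].  In dimension one two ordered random variables
are optimally coupled: for [Z <= Y], the distance [W1] between their laws is at
least [E|Y - Z|] ([W1_ge]).  As the flow preserves the order, the ratio for the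
initial laws [dirac x] and [dirac y] is at least [E|X^x_t - X^y_t| / |x - y|],
which is at least [E|Phi^y_t| e^(- C |x - y|)]; let [x] tend to [y]
([kappa1_le_beta1]). *)

Set Implicit Arguments.
Unset Strict Implicit.

(** * Integral equations and Gronwall estimates *)

Section Calculus.
Context {R : realType}.
Implicit Types (f g h a A : R -> R) (t u v : R).

(** All the equations below are integral equations on the half line; this turns
them into differential equations, with continuity up to time 0. *)
Lemma integral_form_derive (phi psi : R -> R) (c : R) :
  {within `[0, +oo[, continuous psi} ->
  (forall t, 0 <= t ->
    phi t = c + (\int[lebesgue_measure]_(s in `[0%R, t]) psi s)%R) ->
  [/\ phi 0 = c, {within `[0, +oo[, continuous phi} &
      forall t, 0 < t -> is_derive t 1 phi (psi t)].
Proof.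
move=> cpsi phiE.
have int t : lebesgue_measure.-integrable `[0, t] (EFin \o psi).
  apply: continuous_compact_integrable; first exact: segment_compact.
  apply: continuous_subspaceW cpsi => s /=; rewrite !in_itv /= andbT.
  by case/andP.
have dphi t : 0 < t -> is_derive t 1 phi (psi t).
  move=> t0.
  have ct : {for t, continuous psi}.
    have : {in `]0, +oo[, continuous psi}.
      move/continuous_within_itvcyP : cpsi => [+ _]; exact.
    by apply; rewrite in_itv /= t0.
  have tt1 : t < t + 1 by rewrite ltrDl.
  have [dI DI] := continuous_FTC1_closed tt1 (int _) t0 ct.
  set I := (fun x : R => _) in dI DI.
  have dIt : is_derive t 1 I (psi t) by rewrite -DI derive1E; exact/derivableP.
  have H : is_derive t 1 (cst c + I) (psi t).
    by rewrite -[X in is_derive _ _ _ X]add0r; exact: is_deriveD.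
  apply: near_eq_is_derive H; near=> s.
  by rewrite phiE//; apply: ltW; near: s; exact: lt_nbhsr.
have phi0 : phi 0 = c by rewrite phiE// set_itv1 Rintegral_set1 addr0.
split => //.
apply/continuous_within_itvcyP; split.
  move=> x; rewrite in_itv /= andbT => x0.
  apply: differentiable_continuous; apply/derivable1_diffP.
  by have [] := dphi _ x0.
have := parameterized_integral_continuous ler01 (int 1).
move/(continuous_within_itvP _ ltr01) => [_ + _].
rewrite /parameterized_integral.
move/(cvgD (cvg_cst c)) => /=; rewrite -phiE// => H.
apply: cvg_trans H; apply: near_eq_cvg; near=> s.
by rewrite phiE.
Unshelve. all: by end_near. Qed.

(** With [A' = a], the sign of the derivative of [h^2 e^(-2A)] is the sign of
[h h' - a h^2]: both Gronwall estimates below are its monotonicity.  Squaring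
[h] avoids any assumption on the sign of [h]. *)
Lemma gronwall_weight_derive h h' a A t :
  is_derive t 1 h (h' t) -> is_derive t 1 A (a t) ->
  is_derive t 1 (fun s => h s ^+ 2 * expR (- (A s *+ 2)))
    (expR (- (A t *+ 2)) * (h t * h' t - a t * h t ^+ 2) *+ 2).
Proof.
move=> dh dA.
have dE : is_derive t 1 (expR \o (fun s => - (A s *+ 2)))
    (expR (- (A t *+ 2)) * (- (a t *+ 2))).
  have dN : is_derive t 1 (fun s => - (A s *+ 2)) (- (a t *+ 2)).
    have -> : (fun s => - (A s *+ 2)) = - (A + A).
      by apply/funext => s; rewrite mulr2n.
    by rewrite mulr2n; apply: is_deriveN; exact: is_deriveD.
  by apply: is_derive1_comp.
have -> : (fun s => h s ^+ 2 * expR (- (A s *+ 2))) =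
  h ^+ 2 * (expR \o (fun s => - (A s *+ 2))) by apply/funext.
apply: is_derive_eq; rewrite /= /GRing.scale/= fctE /=; ring.
Qed.

Lemma gronwall_weight_continuous h A t :
  {within `[0, t], continuous h} -> {within `[0, t], continuous A} ->
  {within `[0, t], continuous (fun s => h s ^+ 2 * expR (- (A s *+ 2)))}.
Proof.
move=> ch cA x.
apply: cvgM; first by apply: cvgM; exact: ch.
apply: (@continuous_comp (subspace _) _ _ (fun s => - (A s *+ 2)) expR).
  apply: cvgN; rewrite mulr2n.
  have -> : (fun s => A s *+ 2) = (fun s => A s + A s).
    by apply/funext => s; rewrite mulr2n.
  by apply: cvgD; exact: cA.
exact: continuous_expR.
Qed.

Lemma gronwall_le h h' a A t : 0 <= t ->
  {within `[0, t], continuous h} -> {within `[0, t], continuous A} ->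
  (forall s, 0 < s -> s < t -> is_derive s 1 h (h' s)) ->
  (forall s, 0 < s -> s < t -> is_derive s 1 A (a s)) ->
  (forall s, 0 < s -> s < t -> h s * h' s <= a s * h s ^+ 2) ->
  `|h t| <= `|h 0| * expR (A t - A 0).
Proof.
move=> t0 ch cA dh dA H.
pose W s := h s ^+ 2 * expR (- (A s *+ 2)).
have dW s : s \in `]0, t[ -> is_derive s 1 W
    (expR (- (A s *+ 2)) * (h s * h' s - a s * h s ^+ 2) *+ 2).
  rewrite in_itv /= => /andP[s0 st]; apply: gronwall_weight_derive; auto.
have : W t <= W 0.
  apply: (@ler0_derive1_nincr _ W 0 t) => // [s /dW[]//|s st|].
    rewrite derive1E (@derive_val _ _ _ _ _ _ _ (dW s st)).
    rewrite mulrn_wle0// mulr_ge0_le0 ?expR_ge0// subr_le0.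
    by move: st; rewrite in_itv /= => /andP[]; exact: H.
  exact: gronwall_weight_continuous.
rewrite /W => le.
rewrite -ler_sqr ?nnegrE ?mulr_ge0 ?expR_ge0//.
rewrite exprMn !real_normK ?num_real//.
rewrite -(@ler_pM2r _ (expR (- (A t *+ 2)))) ?expR_gt0//.
apply: (le_trans le); rewrite -[leRHS]mulrA.
apply: ler_wpM2l; rewrite ?sqr_ge0//.
by rewrite expr2 -!expRD ler_expR; lra.
Qed.

Lemma gronwall_ge h h' a A t : 0 <= t ->
  {within `[0, t], continuous h} -> {within `[0, t], continuous A} ->
  (forall s, 0 < s -> s < t -> is_derive s 1 h (h' s)) ->
  (forall s, 0 < s -> s < t -> is_derive s 1 A (a s)) ->
  (forall s, 0 < s -> s < t -> a s * h s ^+ 2 <= h s * h' s) ->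
  `|h 0| * expR (A t - A 0) <= `|h t|.
Proof.
move=> t0 ch cA dh dA H.
pose W s := h s ^+ 2 * expR (- (A s *+ 2)).
have dW s : s \in `]0, t[ -> is_derive s 1 W
    (expR (- (A s *+ 2)) * (h s * h' s - a s * h s ^+ 2) *+ 2).
  rewrite in_itv /= => /andP[s0 st]; apply: gronwall_weight_derive; auto.
have : W 0 <= W t.
  apply: (@ger0_derive1_ndecr _ W 0 t) => // [s /dW[]//|s st|].
    rewrite derive1E (@derive_val _ _ _ _ _ _ _ (dW s st)).
    rewrite mulrn_wge0// mulr_ge0 ?expR_ge0// subr_ge0.
    by move: st; rewrite in_itv /= => /andP[]; exact: H.
  exact: gronwall_weight_continuous.
rewrite /W => le.
rewrite -ler_sqr ?nnegrE ?mulr_ge0 ?expR_ge0//.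
rewrite exprMn !real_normK ?num_real//.
rewrite -(@ler_pM2r _ (expR (- (A t *+ 2)))) ?expR_gt0//.
apply: (le_trans _ le); rewrite -[leLHS]mulrA.
apply: ler_wpM2l; rewrite ?sqr_ge0//.
by rewrite expr2 -!expRD ler_expR; lra.
Qed.

Lemma derive_increment f f' u v : (forall x : R, is_derive x 1 f (f' x)) ->
  exists2 c, Num.min u v <= c <= Num.max u v & f u - f v = f' c * (u - v).
Proof.
move=> df.
wlog vu : u v / v <= u => [hw|].
  case/orP: (le_total v u) => [/hw//|/hw[c cE E]].
  by exists c; [rewrite minC maxC|rewrite -opprB E -mulrN opprB].
have cf : {within `[v, u], continuous f}.
  apply: continuous_subspaceT => x; apply: differentiable_continuous.
  by apply/derivable1_diffP; have [] := df x.
have [c] := MVT_segment vu (fun x _ => df x) cf.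
rewrite in_itv /= => cE E; exists c => //.
by rewrite min_r// max_l.
Qed.

Lemma within_itvcy_comp h f : continuous h ->
  {within `[0, +oo[, continuous f} ->
  {within `[0, +oo[, continuous (fun s => h (f s))}.
Proof.
move=> ch cf s; apply: (@continuous_comp (subspace _) _ _ f h); first exact: cf.
exact: ch.
Qed.

Lemma within_itvcy_cc f u v : 0 <= u ->
  {within `[0, +oo[, continuous f} -> {within `[u, v], continuous f}.
Proof.
move=> u0; apply: continuous_subspaceW => s /=.
by rewrite !in_itv /= andbT => /andP[/(le_trans u0)].
Qed.

Lemma path_bounded f t : {within `[0, +oo[, continuous f} ->
  exists2 r : R, 0 <= r & forall s : R, 0 <= s -> s <= t -> `|f s| <= r.
Proof.
move=> cf; case: (leP 0 t) => t0; last first.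
  by exists 0 => // s s0 /(le_trans s0); rewrite leNgt t0.
have cft : {within `[0, t], continuous (fun s => `|f s|)}.
  move=> s; apply: (@continuous_comp (subspace _) _ _ f Num.norm).
    by apply: (within_itvcy_cc (lexx 0) cf).
  exact: norm_continuous.
have [c _ cP] := EVT_max t0 cft; exists `|f c| => // s s0 st.
by apply: cP; rewrite in_itv /= s0.
Qed.

(** The Heine-Cantor theorem, through the near-covering form of compactness:
the size [d] of the admissible increments is the parameter of the covering. *)
Lemma within_itvcy_heine f t e :
  {within `[0, +oo[, continuous f} -> 0 < e ->
  exists2 d : R, 0 < d & forall u v : R, 0 <= u -> u <= t -> 0 <= v ->
    `|u - v| <= d -> `|f u - f v| <= e.
Proof.
move=> cf e0.
pose P (d u : R) := 0 <= u -> forall v : R, 0 <= v -> `|u - v| <= d ->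
  `|f u - f v| <= e.
have /compact_near_coveringP cover := @segment_compact R 0 t.
have : \forall d \near 0^'+, `[0, t] `<=` P d.
  apply: cover => u /=; rewrite in_itv /= => /andP[u0 _].
  have /subspace_continuousP/(_ u) := cf.
  rewrite /= in_itv /= u0 => /(_ isT)/cvgrPdist_lt/(_ (e / 2)).
  rewrite divr_gt0// => /(_ isT); rewrite near_withinE.
  move=> /nbhs_ballP[r /= r0 rP].
  have fP v : 0 <= v -> `|u - v| < r -> `|f u - f v| < e / 2.
    by move=> v0 uv; apply: rP => //=; rewrite in_itv /= v0.
  exists (ball u (r / 2), [set d | d < r / 2]) => /=.
    split; first by apply: nbhsx_ballx; rewrite divr_gt0.
    by apply: nbhs_right_lt; rewrite divr_gt0.
  move=> [w d] /= [uw dr] w0 v v0 wv.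
  rewrite /ball /= in uw.
  have H1 : `|f u - f w| < e / 2 by apply: fP => //; lra.
  have H2 : `|f u - f v| < e / 2.
    apply: fP => //; rewrite -(subrK w u) -addrA.
    by apply: (le_lt_trans (ler_normD _ _)); lra.
  rewrite -(subrK (f u) (f w)) -addrA.
  by apply: (le_trans (ler_normD _ _)); rewrite distrC; lra.
move=> nearP.
have : \forall d \near 0^'+, 0 < d /\ `[0, t] `<=` P d.
  by near=> d; split; near: d => //; exact: nbhs_right_gt.
move=> /filter_ex[d [d0 dP]]; exists d => // u v u0 ut v0 uv.
by apply: dP => //=; rewrite in_itv /= u0.
Unshelve. all: by end_near. Qed.

Lemma ler_expR_slack (r K : R) :
  (forall e, 0 < e -> r <= K * expR e) -> r <= K.
Proof.
move=> H; rewrite leNgt; apply/negP => Kr.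
have r0 : 0 < r.
  rewrite ltNge; apply/negP => r0.
  have K0 : K < 0 by apply: lt_le_trans r0.
  have := H _ ltr01; rewrite leNgt => /negP; apply.
  apply: le_lt_trans Kr.
  by have := expR_ge1Dx (1 : R); nra.
(* With this e, r (1 - e) is the midpoint of r and K, yet at most K. *)
pose e := (r - K) / (2 * r).
have e0 : 0 < e by rewrite divr_gt0 ?subr_gt0// mulr_gt0.
have := H _ e0; rewrite -(@ler_pM2r _ (expR (- e))) ?expR_gt0//.
rewrite -mulrA -expRD subrr expR0 mulr1 => H1.
have H2 : 1 + - e <= expR (- e) by exact: expR_ge1Dx.
have H3 : r * (1 - e) <= r * expR (- e) by rewrite ler_pM2l.
have H4 : r * e = (r - K) / 2.
  by rewrite /e; field; rewrite gt_eqF.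
lra.
Qed.

End Calculus.

(** * The drift *)

Section Drift.
Context {R : realType}.
Variables (b : R -> R) (L M : R).
Hypothesis b_C2 : is_C2 b.
Hypothesis b_bnd : forall x, `|derive1n 2 b x| <= M.
Hypothesis b_lip : one_sided_lipschitz b L.

Lemma drift_derive (x : R) : is_derive x 1 b (derive1 b x).
Proof. by case: b_C2 => db _ _; rewrite derive1E; exact/derivableP. Qed.

Lemma drift_continuous : continuous b.
Proof.
move=> x; apply: differentiable_continuous; apply/derivable1_diffP.
by have [] := drift_derive x.
Qed.

Lemma drift_derive_continuous : continuous (derive1 b).
Proof.
case: b_C2 => _ db _ x; apply: differentiable_continuous.
exact/derivable1_diffP.
Qed.

Lemma drift_derive_lipschitz (x y : R) :
  `|derive1 b x - derive1 b y| <= M * `|x - y|.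
Proof.
have [|c _ ->] := @derive_increment R (derive1 b) (derive1n 2 b) x y.
  by case: b_C2 => _ db _ z; rewrite /= derive1E; exact/derivableP.
by rewrite normrM ler_wpM2r.
Qed.

Lemma bound_ge0 : 0 <= M.
Proof. exact: le_trans (b_bnd 0). Qed.

Lemma drift_taylor (x y : R) :
  `|b x - b y - derive1 b y * (x - y)| <= M * `|x - y| ^+ 2.
Proof.
have [c cE ->] := @derive_increment R b _ x y drift_derive.
rewrite -mulrBl normrM expr2 mulrA ler_wpM2r//.
apply: (le_trans (drift_derive_lipschitz _ _)).
rewrite ler_wpM2l ?bound_ge0//.
case: (leP x y) cE => xy cE.
  by rewrite !ler0_norm; lra.
by rewrite !ger0_norm; lra.
Qed.

Lemma drift_lipschitz_ball (r x y : R) : `|x| <= r -> `|y| <= r ->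
  `|b x - b y| <= (`|derive1 b 0| + M * r) * `|x - y|.
Proof.
move=> xr yr.
have [c cE ->] := @derive_increment R b _ x y drift_derive.
rewrite normrM ler_wpM2r//.
rewrite -[derive1 b c](subrK (derive1 b 0)) addrC.
apply: (le_trans (ler_normD _ _)); rewrite lerD2l.
apply: (le_trans (drift_derive_lipschitz _ _)).
rewrite subr0 ler_wpM2l ?bound_ge0//.
move: xr yr; rewrite !ler_norml => /andP[? ?] /andP[? ?].
by case: (leP x y) cE => xy cE; lra.
Qed.

(** The difference quotient over a step [d] is at most [L], and it differs from
the derivative by at most [M d]. *)
Lemma drift_derive_le (x : R) : derive1 b x <= L.
Proof.
apply/ler_addgt0Pr => e e0.
have M1 : 0 < M + 1 by rewrite ltr_wpDl ?bound_ge0.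
pose d := e / (M + 1).
have d0 : 0 < d by rewrite divr_gt0.
have := b_lip (x + d) x; have := drift_taylor (x + d) x.
rewrite [x + d - x]addrC addKr (gtr0_norm d0) ler_norml => /andP[+ _].
rewrite -(@ler_pM2r _ d)// => H1 H2.
have H3 : derive1 b x * d ^+ 2 <= (L + M * d) * d ^+ 2 by nra.
move: H3; rewrite ler_pM2r ?exprn_gt0// => /le_trans; apply.
by rewrite lerD2l /d mulrCA ler_piMr ?(ltW e0)// ler_pdivrMr// mul1r lerDl.
Qed.

End Drift.

(** * Two paths driven by the same noise *)

Section Paths.
Context {R : realType}.
Variables (b : R -> R) (L M : R).
Hypothesis b_C2 : is_C2 b.
Hypothesis b_bnd : forall x, `|derive1n 2 b x| <= M.
Hypothesis b_lip : one_sided_lipschitz b L.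
Hypothesis L_ge0 : 0 <= L.
Implicit Types s t : R.

Definition path_solution (n f : R -> R) (x : R) : Prop :=
  {within `[0, +oo[, continuous f} /\
  forall t, 0 <= t ->
    f t = x + (\int[lebesgue_measure]_(s in `[0%R, t]) b (f s))%R + n t.

Definition tangent_path (g V : R -> R) (v : R) : Prop :=
  {within `[0, +oo[, continuous V} /\
  forall t, 0 <= t -> V t =
    v + (\int[lebesgue_measure]_(s in `[0%R, t]) (derive1 b (g s) * V s))%R.

(** The noise need not be differentiable, but removing it from the solution
leaves a differentiable path. *)
Lemma path_solution_derive n f x : path_solution n f x ->
  [/\ f 0 - n 0 = x, {within `[0, +oo[, continuous (fun t => f t - n t)} &
      forall t, 0 < t -> is_derive t 1 (fun t => f t - n t) (b (f t))].
Proof.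
case=> cf fE.
apply: (@integral_form_derive _ _ (fun s => b (f s))).
  by apply: within_itvcy_comp => //; exact: drift_continuous b_C2.
by move=> t t0; rewrite fE// addrK.
Qed.

Definition tangent_error t d := M * (d * expR (L * t)) * t.

Section TwoPaths.
Variables (n f g : R -> R) (x y : R).
Hypothesis (fS : path_solution n f x) (gS : path_solution n g y).
Let h := fun t => f t - g t.

Lemma path_difference : [/\ h 0 = x - y, {within `[0, +oo[, continuous h} &
  forall t, 0 < t -> is_derive t 1 h (b (f t) - b (g t))].
Proof.
have [f0 cf df] := path_solution_derive fS.
have [g0 cg dg] := path_solution_derive gS.
have hE : h = (fun t => f t - n t) - (fun t => g t - n t).
  by apply/funext => t; rewrite /h !fctE; ring.
split.
- by rewrite -f0 -g0 /h; ring.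
- by rewrite hE => s; apply: cvgB; [exact: cf|exact: cg].
- by move=> t t0; rewrite hE; apply: is_deriveB; [exact: df|exact: dg].
Qed.

Lemma path_difference_le t : 0 <= t -> `|f t - g t| <= `|x - y| * expR (L * t).
Proof.
move=> t0; have [h0 ch dh] := path_difference.
rewrite -h0 (_ : L * t = L * t - L * 0); last by rewrite mulr0 subr0.
apply: (@gronwall_le _ h (fun s => b (f s) - b (g s)) (cst L) ( *%R L)) => //.
- exact: within_itvcy_cc ch.
- by apply: continuous_subspaceT => s; exact: mulrl_continuous.
- by move=> s s0 _; exact: dh.
- move=> s _ _; rewrite -[X in is_derive _ _ _ X]mulr1.
  exact: is_deriveZ.
- by move=> s _ _; have := b_lip (f s) (g s); rewrite real_normK ?num_real.
Qed.

Let A t := (\int[lebesgue_measure]_(s in `[0%R, t]) derive1 b (g s))%R.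

Lemma tangent_exponent : [/\ A 0 = 0, {within `[0, +oo[, continuous A} &
  forall t, 0 < t -> is_derive t 1 A (derive1 b (g t))].
Proof.
case: gS => cg _.
apply: (@integral_form_derive _ _ (fun s => derive1 b (g s))).
  by apply: within_itvcy_comp => //; exact: drift_derive_continuous b_C2.
by move=> t t0; rewrite add0r.
Qed.

(** Taylor's formula gives [h h' = b'(g) h^2 + O(|h|^3)], and the a priori bound
[path_difference_le] makes the remainder at most [c h^2] with [c] of the order
of [|x - y|].  So [h] grows at a rate between [b'(g) - c] and [b'(g) + c]. *)
Lemma path_difference_exponent t : 0 <= t ->
  `|x - y| * expR (A t) * expR (- tangent_error t `|x - y|) <= `|f t - g t| /\
  `|f t - g t| <= `|x - y| * expR (A t) * expR (tangent_error t `|x - y|).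
Proof.
move=> t0; have [h0 ch dh] := path_difference.
have [A0 cA dA] := tangent_exponent.
rewrite -!mulrA -!expRD.
pose c := M * (`|x - y| * expR (L * t)).
have M0 : 0 <= M by apply: bound_ge0 b_bnd.
have c0 : 0 <= c by rewrite !mulr_ge0 ?expR_ge0.
have key s : 0 < s -> s < t ->
    `|h s * (b (f s) - b (g s)) - derive1 b (g s) * h s ^+ 2| <= c * h s ^+ 2.
  move=> s0 st.
  have -> : h s * (b (f s) - b (g s)) - derive1 b (g s) * h s ^+ 2 =
     h s * (b (f s) - b (g s) - derive1 b (g s) * (f s - g s)).
    by rewrite /h; ring.
  have := drift_taylor b_C2 b_bnd (f s) (g s); rewrite -/(h s) => T.
  rewrite normrM -[h s ^+ 2]real_normK ?num_real// expr2 mulrA [leLHS]mulrC.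
  rewrite ler_wpM2r//; apply: (le_trans T); rewrite expr2 mulrA ler_wpM2r//.
  rewrite ler_wpM2l//; apply: (le_trans (path_difference_le (ltW s0))).
  by rewrite ler_wpM2l// ler_expR ler_wpM2l// ltW.
have cAc k : {within `[0, t], continuous (A + *%R k)}.
  move=> s; apply: cvgD; first exact: (within_itvcy_cc (lexx 0) cA).
  by apply: continuous_subspaceT => u; exact: mulrl_continuous.
have dAc k s : 0 < s -> s < t -> is_derive s 1 (A + *%R k)
    (derive1 b (g s) + k).
  move=> s0 _; apply: is_deriveD; first exact: dA.
  by rewrite -[X in is_derive _ _ _ X]mulr1; exact: is_deriveZ.
have E k : (A + *%R k) t - (A + *%R k) 0 = A t + k * t.
  by rewrite !fctE A0 mulr0 addr0 subr0.
have -> : - tangent_error t `|x - y| = (- c) * t.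
  by rewrite /tangent_error /c mulNr.
have -> : tangent_error t `|x - y| = c * t by [].
rewrite -/(h t) -!E -h0.
split.
- apply: (gronwall_ge t0 (within_itvcy_cc (lexx 0) ch) (cAc _)
    (fun s p _ => dh s p) (dAc _)) => s s0 st.
  by have := key s s0 st; rewrite ler_norml => /andP[]; lra.
- apply: (gronwall_le t0 (within_itvcy_cc (lexx 0) ch) (cAc _)
    (fun s p _ => dh s p) (dAc _)) => s s0 st.
  by have := key s s0 st; rewrite ler_norml => /andP[]; lra.
Qed.

(** By the lower bound above the difference never vanishes, so by continuity it
keeps its initial sign. *)
Lemma path_order t : 0 <= t -> y < x -> g t <= f t.
Proof.
move=> t0 yx; rewrite leNgt; apply/negP => fg.
have [h0 ch dh] := path_difference.
have [||s] := @IVT _ h 0 t 0 t0.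
- exact: within_itvcy_cc ch.
- have ? : h t < 0 by rewrite /h subr_lt0.
  have ? : 0 < h 0 by rewrite h0 subr_gt0.
  rewrite ge_min le_max; lra.
rewrite in_itv /= => /andP[s0 st] hs.
have [+ _] := path_difference_exponent s0.
rewrite -/(h s) hs normr0 leNgt => /negP; apply.
by rewrite !mulr_gt0 ?expR_gt0// normr_gt0 subr_eq0 gt_eqF.
Qed.

Variables (V : R -> R) (v : R).
Hypothesis VS : tangent_path g V v.
Hypothesis v1 : `|v| = 1.

Lemma tangent_derive : [/\ V 0 = v, {within `[0, +oo[, continuous V} &
  forall t, 0 < t -> is_derive t 1 V (derive1 b (g t) * V t)].
Proof.
case: gS => cg _; case: VS => cV VE.
apply: (@integral_form_derive _ _ (fun s => derive1 b (g s) * V s)) => //.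
move=> s; apply: cvgM; last exact: cV.
by apply: within_itvcy_comp => //; exact: drift_derive_continuous b_C2.
Qed.

Lemma tangent_norm t : 0 <= t -> `|V t| = expR (A t).
Proof.
move=> t0; have [A0 cA dA] := tangent_exponent.
have [V0 cV dV] := tangent_derive.
rewrite -[expR _]mul1r -[1]v1 -V0 (_ : A t = A t - A 0); last first.
  by rewrite A0 subr0.
apply/le_anti/andP; split.
- apply: (gronwall_le t0 (within_itvcy_cc (lexx 0) cV)
    (within_itvcy_cc (lexx 0) cA) (fun s p _ => dV s p)
    (fun s p _ => dA s p)) => s _ _; lra.
- apply: (gronwall_ge t0 (within_itvcy_cc (lexx 0) cV)
    (within_itvcy_cc (lexx 0) cA) (fun s p _ => dV s p)
    (fun s p _ => dA s p)) => s _ _; lra.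
Qed.

Lemma tangent_le t : 0 <= t -> `|V t| <= expR (L * t).
Proof.
move=> t0; have [V0 cV dV] := tangent_derive.
rewrite -[expR _]mul1r -v1 -V0 (_ : L * t = L * t - L * 0); last first.
  by rewrite mulr0 subr0.
apply: (@gronwall_le _ V _ (cst L) ( *%R L) t t0 (within_itvcy_cc (lexx 0) cV)
   _ (fun s p _ => dV s p)) => //.
- by apply: continuous_subspaceT => s; exact: mulrl_continuous.
- move=> s _ _; rewrite -[X in is_derive _ _ _ X]mulr1.
  exact: is_deriveZ.
- move=> s _ _ /=; rewrite mulrCA -expr2 ler_wpM2r ?sqr_ge0//.
  exact: drift_derive_le b_C2 b_bnd b_lip _.
Qed.

Lemma path_difference_tangent t : 0 <= t ->
  `|x - y| * `|V t| * expR (- tangent_error t `|x - y|) <= `|f t - g t| /\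
  `|f t - g t| <= `|x - y| * `|V t| * expR (tangent_error t `|x - y|).
Proof.
by move=> t0; rewrite (tangent_norm t0); exact: path_difference_exponent.
Qed.

End TwoPaths.
End Paths.

(** * Pathwise convergence of the Euler scheme *)

Section Euler.
Context {R : realType}.
Variables (b : R -> R) (M : R).
Hypothesis b_C2 : is_C2 b.
Hypothesis b_bnd : forall x, `|derive1n 2 b x| <= M.

Fixpoint euler (n : R -> R) (h x : R) (k : nat) : R :=
  if k is k'.+1 then
    euler n h x k' + h * b (euler n h x k')
      + (n (k'.+1%:R * h) - n (k'%:R * h))
  else x.

(** The drift may grow quadratically, and the scheme may explode in mean; but a
given solution is bounded on [[0, t]], and as long as the scheme stays within
distance 1 of it, both live in a ball where the drift is [K]-Lipschitz.  There
the error after time [s] is at most [d (e^(K s) - 1)], where [d] bounds the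
oscillation of the solution over one step, and for [d] small this is indeed less
than 1 up to time [t]. *)
Lemma euler_cvg (n f : R -> R) (x t : R) : path_solution b n f x -> f 0 = x ->
  0 <= t -> euler n (t / m.+1%:R) x m.+1 @[m --> \oo] --> f t.
Proof.
move=> fS f0 t0; have [cf _] := fS.
have [_ cF dF] := path_solution_derive b_C2 fS.
have [r r0 fr] := path_bounded t cf.
have M0 : 0 <= M by apply: bound_ge0 b_bnd.
pose K := `|derive1 b 0| + M * (r + 1).
have K0 : 0 <= K by rewrite addr_ge0// mulr_ge0// addr_ge0.
apply/cvgrPdist_le => e e0.
pose e1 := Num.min e 1.
have e10 : 0 < e1 by rewrite lt_min e0 ltr01.
pose d := e1 * expR (- (K * t)).
have d0 : 0 < d by rewrite mulr_gt0 ?expR_gt0.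
have [del del0 heine] := within_itvcy_heine t cf d0.
suff H (h : R) (k : nat) : 0 <= h -> h <= del -> k%:R * h <= t ->
    `|f (k%:R * h) - euler n h x k| <= d * (expR (K * (k%:R * h)) - 1).
  near=> m; have m0 : (m.+1%:R : R) != 0 by rewrite pnatr_eq0.
  have mt : m.+1%:R * (t / m.+1%:R) = t by rewrite mulrC divfK.
  rewrite -[in f t]mt.
  apply: (le_trans (H _ _ _ _ _)).
  - by rewrite divr_ge0.
  - rewrite ler_pdivrMr ?ltr0n//.
    have : t / del <= m.+1%:R.
      apply: (@le_trans _ _ m%:R); last by rewrite ler_nat.
      by near: m; exact: nbhs_infty_ger.
    by rewrite ler_pdivrMr// mulrC.
  - by rewrite mt.
  - rewrite mt mulrBr mulr1 /d -mulrA -expRD addNr expR0 mulr1.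
    apply: (@le_trans _ _ e1); last by rewrite ge_min lexx.
    by rewrite lerBlDr lerDl ltW.
move=> h0 hdel.
elim: k => [_|k IH kt].
  by rewrite !mul0r mulr0 expR0 subrr mulr0 f0 subrr normr0.
set s := k%:R * h; set s' := k.+1%:R * h.
have s'E : s' = s + h by rewrite /s' /s -addn1 natrD mulrDl mul1r.
have s0 : 0 <= s by rewrite mulr_ge0.
have ss' : s <= s' by rewrite s'E lerDl.
have st : s <= t by apply: le_trans kt.
have {}IH := IH st; rewrite -/s in IH.
set Y := euler n h x k in IH *.
have Ks : K * s <= K * t by rewrite ler_wpM2l.
have IH1 : `|f s - Y| <= 1.
  apply: (le_trans IH); rewrite mulrBr mulr1.
  apply: (@le_trans _ _ e1); last by rewrite ge_min lexx orbT.
  rewrite lerBlDr (@le_trans _ _ (e1))// ?lerDl ?(ltW d0)//.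
  rewrite /d -mulrA -expRD ler_piMr ?(ltW e10)//.
  by rewrite expR_le1 addrC subr_le0.
(* The mean value theorem evaluates exactly the noise-free increment of f. *)
have [||c cE E] :=
  @MVT_segment _ (fun u => f u - n u) (fun u => b (f u)) _ _ ss'.
- move=> u; rewrite in_itv /= => /andP[su _]; apply: dF.
  exact: le_lt_trans su.
- exact: within_itvcy_cc cF.
move: cE; rewrite in_itv /= => /andP[sc cs'].
have -> : f s' - euler n h x k.+1 = (f s - Y) + h * (b (f c) - b Y).
  have -> : euler n h x k.+1 = Y + h * b Y + (n s' - n s) by [].
  have ss : s' - s = h by rewrite s'E addrC addKr.
  rewrite /= ss in E.
  lra.
have fc : `|f c| <= r + 1.
  by rewrite (@le_trans _ _ r)// ?lerDl// fr// ?(le_trans s0)// (le_trans cs').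
have Yr : `|Y| <= r + 1.
  rewrite -[Y](subrK (f s)) addrC; apply: (le_trans (ler_normD _ _)).
  by rewrite lerD// ?fr// distrC.
have fsc : `|f c - f s| <= d.
  rewrite distrC; apply: heine => //; first exact: le_trans sc.
  by rewrite distrC ger0_norm ?subr_ge0//; lra.
have bb : `|b (f c) - b Y| <= K * (d + `|f s - Y|).
  apply: (le_trans (drift_lipschitz_ball b_C2 b_bnd fc Yr)).
  rewrite -/K ler_wpM2l// -(subrK (f s) (f c)) -addrA.
  by apply: (le_trans (ler_normD _ _)); rewrite lerD2r.
apply: (le_trans (ler_normD _ _)); rewrite normrM (ger0_norm h0).
have Kh : 0 <= K * h by rewrite mulr_ge0.
have H1 : h * `|b (f c) - b Y| <= h * (K * (d + `|f s - Y|)).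
  by rewrite ler_wpM2l.
rewrite s'E (mulrDr K) expRD.
have H2 : 1 + K * h <= expR (K * h) by exact: expR_ge1Dx.
have H3 : (1 + K * h) * `|f s - Y| <= (1 + K * h) * (d * (expR (K * s) - 1)).
  by rewrite ler_wpM2l// addr_ge0.
have H4 : d * expR (K * s) * (1 + K * h) <= d * expR (K * s) * expR (K * h).
  by rewrite ler_wpM2l// mulr_ge0 ?expR_ge0 ?ltW.
lra.
Unshelve. all: by end_near. Qed.

End Euler.

(** * Product and image laws *)

Section ProductLaw.
Context {d1 d2 : measure_display} {T1 : measurableType d1}
  {T2 : measurableType d2} {R : realType}.
Variables (p : probability T1 R) (q : probability T2 R).
Local Open Scope ereal_scope.

Definition product_law : set (T1 * T2) -> \bar R := p \x q.

HB.instance Definition _ := Measure.on product_law.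

Lemma product_law_setT : product_law setT = 1.
Proof.
transitivity (p setT * q setT); last by rewrite !probability_setT mule1.
by rewrite /product_law -setXTT product_measure1E.
Qed.

HB.instance Definition _ :=
  Measure_isProbability.Build _ _ _ product_law product_law_setT.

End ProductLaw.

Section ImageLaw.
Context {d1 d2 : measure_display} {T1 : measurableType d1}
  {T2 : measurableType d2} {R : realType}.
Local Open Scope ereal_scope.

Definition image_law (p : probability T1 R) (f : T1 -> T2)
    (mf : measurable_fun setT f) : probability T2 R :=
  distribution p (mfun_Sub (mem_set mf)).

Lemma ge0_integral_image_law (p : probability T1 R) (f : T1 -> T2)
    (mf : measurable_fun setT f) (h : T2 -> \bar R) :
  measurable_fun setT h -> (forall y, 0 <= h y) ->
  \int[image_law p mf]_y h y = \int[p]_x h (f x).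
Proof. exact: ge0_integral_distribution. Qed.

End ImageLaw.

Section AlmostSure.
Context {d : measure_display} {T : measurableType d} {R : realType}.
Variable P : probability T R.

Lemma ae_eq_measure (E F : set T) : measurable E -> measurable F ->
  {ae P, forall w, E w <-> F w} -> P E = P F.
Proof.
move=> mE mF EF; rewrite -[E]setIT -[F]setIT -!integral_indic//.
apply: ae_eq_integral => //.
- by apply: measurableT_comp => //; exact: measurable_indic.
- by apply: measurableT_comp => //; exact: measurable_indic.
apply: filterS EF => w EF _; congr (_%:E); rewrite !indicE.
by congr (_%:R); congr nat_of_bool; apply/idP/idP; rewrite !inE => /EF.
Qed.

Lemma integral_probability_cst (r : R) : (\int[P]_w r%:E)%E = r%:E.
Proof.
rewrite integral_cst// [X in (_ * X)%E](_ : _ = 1%E) ?mule1//.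
exact: probability_setT.
Qed.

Lemma measurable_norm_RV (Y : {RV P >-> R}) :
  measurable_fun setT (fun w => `|Y w|%:E).
Proof. by apply: measurableT_comp => //; apply: measurableT_comp. Qed.

Lemma measurable_dist_RV (Y Z : {RV P >-> R}) :
  measurable_fun setT (fun w => `|Y w - Z w|%:E).
Proof.
by apply: measurableT_comp => //; apply: measurableT_comp => //;
  exact: measurable_funB.
Qed.

Lemma integral_law (V : {RV P >-> R}) (rho : probability R R)
    (h : R -> \bar R) :
  (forall A, measurable A -> distribution P V A = rho A) ->
  measurable_fun setT h -> (forall x, 0 <= h x)%E ->
  (\int[rho]_x h x = \int[P]_w h (V w))%E.
Proof.
move=> Vl mh h0; rewrite -[RHS](@ge0_integral_distribution _ _ _ _ _ P V h)//.
by apply: eq_measure_integral => A mA _; apply/esym; exact: Vl.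
Qed.

End AlmostSure.

(** * Transporting couplings along a random flow *)

Section Coupling.
Context {d : measure_display} {S : measurableType d} {R : realType}.
Variables (q : probability S R) (F : R * S -> R).
Hypothesis mF : measurable_fun setT F.
Local Open Scope ereal_scope.

Lemma measurable_flow_pair : measurable_fun setT
  (fun z : (R * R) * S => (F (z.1.1, z.2), F (z.1.2, z.2))).
Proof.
apply: measurable_fun_pair; apply: (measurableT_comp mF);
  apply: measurable_fun_pair => //.
- exact: (measurableT_comp measurable_fst).
- exact: (measurableT_comp measurable_snd).
Qed.

Lemma measurable_dist : measurable_fun setT (fun z : R * R => `|z.1 - z.2|%:E).
Proof.
apply: measurableT_comp => //; apply: measurableT_comp => //.
by apply: measurable_funB.
Qed.

Lemma product_marginal_left (gamma : probability (R * R)%type R)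
    (nu : probability R R) (C : set (R * S)) :
  (forall A, measurable A -> gamma (A `*` setT) = nu A) -> measurable C ->
  product_law gamma q ((fun z => (z.1.1, z.2)) @^-1` C) = (nu \x q) C.
Proof.
move=> gnu mC.
have mp : measurable_fun setT (fun z : (R * R) * S => (z.1.1, z.2)).
  apply: measurable_fun_pair => //.
  exact: (measurableT_comp measurable_fst).
rewrite (@product_measure_unique _ _ _ _ _ nu q
  (image_law (product_law gamma q) mp))//.
move=> A B mA mB.
transitivity ((gamma \x q) ((A `*` setT) `*` B)).
  congr ((gamma \x q) _); apply/seteqP; split => [[[x y] w] /= [? ?]//|].
  by move=> [[x y] w] [[]].
have mAT : measurable (A `*` [set: R]) by exact: measurableX.
by rewrite product_measure1E//; congr (_ * _); exact: gnu.
Qed.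

Lemma product_marginal_right (gamma : probability (R * R)%type R)
    (nu : probability R R) (C : set (R * S)) :
  (forall A, measurable A -> gamma (setT `*` A) = nu A) -> measurable C ->
  product_law gamma q ((fun z => (z.1.2, z.2)) @^-1` C) = (nu \x q) C.
Proof.
move=> gnu mC.
have mp : measurable_fun setT (fun z : (R * R) * S => (z.1.2, z.2)).
  apply: measurable_fun_pair => //.
  exact: (measurableT_comp measurable_snd).
rewrite (@product_measure_unique _ _ _ _ _ nu q
  (image_law (product_law gamma q) mp))//.
move=> A B mA mB.
transitivity ((gamma \x q) ((setT `*` A) `*` B)).
  congr ((gamma \x q) _); apply/seteqP; split => [[[x y] w] /= [? ?]//|].
  by move=> [[x y] w] [[]].
have mAT : measurable ([set: R] `*` A) by exact: measurableX.
by rewrite product_measure1E//; congr (_ * _); exact: gnu.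
Qed.

Lemma W1_ge0 (m1 m2 : probability R R) : 0 <= W1 m1 m2.
Proof. by apply/ereal_infP => _ [g _ <-]; apply: integral_ge0. Qed.

Variable k : R.
Hypothesis k_ge0 : (0 <= k)%R.
Hypothesis F_lip : forall x y : R,
  \int[q]_w `|F (x, w) - F (y, w)|%:E <= (k * `|x - y|)%:E.

Variables nu mu nu' mu' : probability R R.
Hypothesis nu'E : forall A, measurable A -> nu' A = (nu \x q) (F @^-1` A).
Hypothesis mu'E : forall A, measurable A -> mu' A = (mu \x q) (F @^-1` A).

(** Draw [(x, y)] from [gamma] and, independently, one noise [w] shared by both
components: [(F (x, w), F (y, w))] is a coupling of [nu'] and [mu'], and by
Fubini its cost is estimated for fixed [(x, y)]. *)
Lemma W1_flow_coupling (gamma : probability (R * R)%type R) :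
  coupling nu mu gamma ->
  W1 nu' mu' <= k%:E * \int[gamma]_z `|z.1 - z.2|%:E.
Proof.
move=> cg.
pose g' := image_law (product_law gamma q) measurable_flow_pair.
have cg' : coupling nu' mu' g'.
  move=> A mA; have mFA : measurable (F @^-1` A).
    by rewrite -[X in measurable X]setTI; exact: mF.
  split.
  - rewrite nu'E// -(@product_marginal_left gamma)//; last by move=> B /cg[].
    congr (product_law gamma q _); apply/seteqP.
    by split => [[[x y] w] /= []|[[x y] w]].
  - rewrite mu'E// -(@product_marginal_right gamma)//; last by move=> B /cg[].
    congr (product_law gamma q _); apply/seteqP.
    by split => [[[x y] w] /= []|[[x y] w]].
apply: (@le_trans _ _ (\int[g']_z `|z.1 - z.2|%:E)).
  by apply: ereal_inf_lbound; exists g'.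
rewrite ge0_integral_image_law//; last exact: measurable_dist.
have mD : measurable_fun setT
    (fun z : (R * R) * S => `|F (z.1.1, z.2) - F (z.1.2, z.2)|%:E).
  exact: (measurableT_comp measurable_dist measurable_flow_pair).
rewrite (@fubini_tonelli1 _ _ _ _ _ gamma q _ mD)//.
rewrite -ge0_integralZl_EFin//; last exact: measurable_dist.
apply: ge0_le_integral => //.
- by move=> z _; apply: integral_ge0.
- exact: measurable_fun_fubini_tonelli_F.
- by apply: measurable_funeM; exact: measurable_dist.
- by move=> [x y] _; rewrite /fubini_F /= -EFinM.
Qed.

(** The quotient makes sense for every value of the denominator: an infinite one
gives 0, and a vanishing one forces the numerator to vanish too, where
[0 / 0 = 0 * +oo = 0]. *)
Lemma W1_flow_ratio : W1 nu' mu' / W1 nu mu <= k%:E.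
Proof.
case Ew : (W1 nu mu) => [w||]; last 2 first.
- by rewrite invey mule0 lee_fin.
- by have := W1_ge0 nu mu; rewrite Ew.
have Wle : W1 nu' mu' <= (k * w)%:E.
  apply/lee_addgt0Pr => e e0.
  have k1 : (0 < k + 1)%R by rewrite ltr_wpDl.
  have : ereal_inf [set \int[g]_z `|z.1 - z.2|%:E | g in coupling nu mu] <
      (w + e / (k + 1))%:E.
    by rewrite -/(W1 nu mu) Ew lte_fin ltrDl divr_gt0.
  move=> /ereal_inf_lt[_ [g cg <-] /ltW gw].
  apply: (le_trans (W1_flow_coupling cg)).
  apply: (le_trans (lee_wpmul2l _ gw)); first by rewrite lee_fin.
  rewrite -EFinM -EFinD lee_fin mulrDr lerD2l mulrCA ler_piMr ?(ltW e0)//.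
  by rewrite ler_pdivrMr// mul1r lerDl.
have := W1_ge0 nu mu; rewrite Ew lee_fin le_eqVlt => /predU1P[w0|w0].
  rewrite -w0 mulr0 in Wle.
  have -> : W1 nu' mu' = 0 by apply/le_anti; rewrite Wle W1_ge0.
  by rewrite mul0e lee_fin.
by rewrite inver gt_eqF// lee_pdivrMr// -EFinM.
Qed.

End Coupling.

(** * Wasserstein distance between ordered random variables *)

Section W1LowerBound.
Context {R : realType}.

(** Truncation at levels [-N] and [N], shifted by [N] so as to be nonnegative:
it makes the means below finite without any integrability assumption. *)
Definition clip (N u : R) : R := Num.max 0 (Num.min (u + N) (N + N)).

Lemma clip_ge0 N u : 0 <= clip N u.
Proof. by rewrite le_max lexx. Qed.

Lemma clip_le N u : 0 <= N -> clip N u <= N + N.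
Proof. by move=> N0; rewrite ge_max addr_ge0//= ge_min lexx orbT. Qed.

Lemma clipP N u : 0 <= N ->
  [\/ u <= - N /\ clip N u = 0, - N <= u <= N /\ clip N u = u + N |
      N <= u /\ clip N u = N + N].
Proof.
move=> N0; rewrite /clip; case: (leP (u + N) (N + N)) => uN.
  case: (leP 0 (u + N)) => u0; first by constructor 2; split=> //; lra.
  by constructor 1; split=> //; lra.
by rewrite max_r ?addr_ge0//; constructor 3; split=> //; lra.
Qed.

Lemma clip_le_homo N u v : 0 <= N -> v <= u -> clip N v <= clip N u.
Proof.
by move=> N0 vu; case: (clipP u N0) => -[? ->];
  case: (clipP v N0) => -[? ->]; lra.
Qed.

Lemma clip_lipschitz N u v : 0 <= N -> `|clip N u - clip N v| <= `|u - v|.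
Proof.
move=> N0; wlog uv : u v / v <= u => [hw|].
  by case/orP: (le_total v u) => [/hw//|/hw]; rewrite distrC [leRHS]distrC.
rewrite !ger0_norm ?subr_ge0 ?clip_le_homo//.
by case: (clipP u N0) => -[? ->]; case: (clipP v N0) => -[? ->]; lra.
Qed.

Lemma clip_nested N N' u : 0 <= N -> N <= N' ->
  clip N u = clip N (clip N' u - N').
Proof.
move=> N0 NN; have N'0 := le_trans N0 NN.
by case: (clipP (clip N' u - N') N0) => -[+ ->];
  case: (clipP u N'0) => -[? ->]; case: (clipP u N0) => -[? ->]; lra.
Qed.

Lemma clip_dist_homo N N' u v : 0 <= N -> N <= N' ->
  `|clip N u - clip N v| <= `|clip N' u - clip N' v|.
Proof.
move=> N0 NN; rewrite (clip_nested u N0 NN) (clip_nested v N0 NN).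
apply: (le_trans (clip_lipschitz _ _ N0)).
by rewrite opprB addrA subrK.
Qed.

Lemma clip_id N u : `|u| <= N -> clip N u = u + N.
Proof.
rewrite ler_norml => /andP[? ?]; rewrite /clip min_l ?max_r//; lra.
Qed.

Lemma measurable_clip N : measurable_fun setT (clip N).
Proof.
apply: measurable_maxr => //; apply: measurable_minr => //.
by apply: measurable_funD.
Qed.

Local Open Scope ereal_scope.

Lemma integral_marginal_left (gamma : probability (R * R)%type R)
    (nu : probability R R) (h : R -> \bar R) :
  (forall A, measurable A -> gamma (A `*` setT) = nu A) ->
  measurable_fun setT h -> (forall x, 0 <= h x) ->
  \int[gamma]_z h z.1 = \int[nu]_x h x.
Proof.
move=> gnu mh h0.
rewrite -(@ge0_integral_image_law _ _ _ _ _ gamma fst measurable_fst)//.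
apply: eq_measure_integral => A mA _.
transitivity (gamma (A `*` setT)); last exact: gnu.
congr (gamma _); apply/seteqP; split => [[x y]//=|[x y] []//].
Qed.

Lemma integral_marginal_right (gamma : probability (R * R)%type R)
    (nu : probability R R) (h : R -> \bar R) :
  (forall A, measurable A -> gamma (setT `*` A) = nu A) ->
  measurable_fun setT h -> (forall x, 0 <= h x) ->
  \int[gamma]_z h z.2 = \int[nu]_x h x.
Proof.
move=> gnu mh h0.
rewrite -(@ge0_integral_image_law _ _ _ _ _ gamma snd measurable_snd)//.
apply: eq_measure_integral => A mA _.
transitivity (gamma (setT `*` A)); last exact: gnu.
congr (gamma _); apply/seteqP; split => [[x y]//=|[x y] []//].
Qed.

Context {d : measure_display} {T : measurableType d}.
Variables (P : probability T R) (Y Z : {RV P >-> R}) (nu mu : probability R R).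
Hypothesis Y_law : forall A, measurable A -> distribution P Y A = nu A.
Hypothesis Z_law : forall A, measurable A -> distribution P Z A = mu A.
Hypothesis ZY : {ae P, forall w, (Z w <= Y w)%R}.

(** The easy half of Kantorovich duality, tested on the 1-Lipschitz function
[clip N]: any coupling costs at least the difference of the means of
[clip N Y] and [clip N Z], and as [Z <= Y] this difference is the mean of
[|clip N Y - clip N Z|]. *)
Lemma W1_ge_clip (N : R) : (0 <= N)%R ->
  \int[P]_w `|clip N (Y w) - clip N (Z w)|%:E <= W1 nu mu.
Proof.
move=> N0; apply/ereal_infP => _ [g cg <-].
pose h u : \bar R := (clip N u)%:E.
have h0 u : 0 <= h u by rewrite lee_fin clip_ge0.
have mh : measurable_fun setT h.
  by apply: measurableT_comp => //; exact: measurable_clip.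
have mhV (V : {RV P >-> R}) : measurable_fun setT (fun w => h (V w)).
  exact: (measurableT_comp mh).
have mcV (V : {RV P >-> R}) : measurable_fun setT (fun w => clip N (V w)).
  by apply: (measurableT_comp (measurable_clip N)).
have Zfin : \int[P]_w h (Z w) \is a fin_num.
  rewrite ge0_fin_numE; last by apply: integral_ge0.
  apply: (@le_lt_trans _ _ (\int[P]_w (N + N)%:E)).
    by apply: ge0_le_integral => // w _; rewrite lee_fin clip_le.
  by rewrite integral_probability_cst ltry.
rewrite -(leeD2rE _ _ Zfin).
have mdV : measurable_fun setT (fun w => `|clip N (Y w) - clip N (Z w)|%:E).
  by apply: measurableT_comp => //; apply: measurableT_comp => //;
    exact: measurable_funB.
have -> : \int[P]_w `|clip N (Y w) - clip N (Z w)|%:E + \int[P]_w h (Z w) =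
    \int[P]_w h (Y w).
  rewrite -ge0_integralD//; apply: ae_eq_integral => //.
    exact: emeasurable_funD.
  apply: filterS ZY => w zy _; rewrite -EFinD ger0_norm ?subrK//.
  by rewrite subr_ge0 clip_le_homo.
rewrite -(integral_law Y_law mh h0) -(integral_law Z_law mh h0).
rewrite -(integral_marginal_left (gamma:=g))//; last by move=> A /cg[].
rewrite -[X in _ + X](integral_marginal_right (gamma:=g))//; last first.
  by move=> A /cg[].
rewrite -ge0_integralD//; last 2 first.
- exact: measurable_dist.
- exact: (measurableT_comp mh measurable_snd).
apply: ge0_le_integral => //.
- exact: (measurableT_comp mh measurable_fst).
- apply: emeasurable_funD; first exact: measurable_dist.
  exact: (measurableT_comp mh measurable_snd).
- move=> [u v] _ /=; rewrite lee_fin -lerBlDr.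
  by apply: (le_trans (ler_norm _)); exact: clip_lipschitz.
Qed.

(** Monotone convergence as the truncation level grows: truncated distances are
nondecreasing in [N] by [clip_dist_homo]. *)
Lemma W1_ge : \int[P]_w `|Y w - Z w|%:E <= W1 nu mu.
Proof.
pose g (n : nat) (w : T) : \bar R := `|clip n%:R (Y w) - clip n%:R (Z w)|%:E.
have mg n : measurable_fun setT (g n).
  apply: measurableT_comp => //; apply: measurableT_comp => //.
  by apply: measurable_funB; apply: (measurableT_comp (measurable_clip _)).
have g0 n w : setT w -> 0 <= g n w by move=> _; rewrite lee_fin.
have gh w : setT w -> {homo g^~ w : n m / (n <= m)%N >-> n <= m}.
  by move=> _ n m nm; rewrite lee_fin clip_dist_homo// ler_nat.
have gcvg := @cvg_monotone_convergence _ _ _ P _ measurableT _ mg g0 gh.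
have -> : \int[P]_w `|Y w - Z w|%:E = \int[P]_w limn (g^~ w).
  apply: eq_integral => w _; apply/esym/cvg_lim => //.
  apply: cvg_near_cst; near=> n; rewrite /g !clip_id.
  - by congr (`|_|%:E); lra.
  - by near: n; exact: nbhs_infty_ger.
  - by near: n; exact: nbhs_infty_ger.
rewrite -(cvg_lim _ gcvg)//; apply: lime_le.
  by apply/cvg_ex; eexists; exact: gcvg.
by apply: nearW => n; exact: W1_ge_clip.
Unshelve. all: by end_near. Qed.

End W1LowerBound.

(** * Solutions as a measurable function of the initial value and the noise *)

Section NoiseFlow.
Context {d : measure_display} {T : measurableType d} {R : realType}.
Variables (P : probability T R) (B : R -> {RV P >-> R}).

Definition noise_events : set (set T) :=
  [set E | exists u (A : set R),
    [/\ `[0, +oo[%classic u, measurable A & E = B u @^-1` A]].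

(** The sample space with only the events of the noise, so that joint
measurability in the product with [R] expresses adaptedness to the noise. *)
Definition noise_space := g_sigma_algebraType noise_events.

Lemma noise_measurable (E : set T) : <<s noise_events >> E -> measurable E.
Proof.
apply: smallest_sub; first exact: sigma_algebra_measurable.
move=> _ [u [A [_ mA ->]]].
by rewrite -[X in measurable X]setTI; exact: measurable_funP.
Qed.

Lemma measurable_noise_id :
  @measurable_fun _ _ T noise_space setT (fun w : T => w).
Proof. by move=> _ E mE; rewrite setTI; exact: noise_measurable. Qed.

Definition noise_law : probability noise_space R :=
  image_law P measurable_noise_id.

Lemma measurable_noise (u : R) : 0 <= u ->
  measurable_fun setT (fun w : noise_space => B u w).
Proof.
move=> u0 _ A mA; rewrite setTI; apply: sub_sigma_algebra.
by exists u, A; split => //=; rewrite in_itv /= u0.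
Qed.

Variables (b : R -> R) (sigma : R).
Hypothesis cb : continuous b.

Lemma measurable_euler (h : R) (k : nat) : 0 <= h ->
  measurable_fun setT (fun z : R * noise_space =>
    euler b (fun u => sigma * B u z.2) h z.1 k).
Proof.
move=> h0; elim: k => [|k IH] /=; first exact: measurable_fst.
have mB u : 0 <= u -> measurable_fun setT
    (fun z : R * noise_space => sigma * B u z.2).
  move=> u0; apply: measurable_funM => //.
  exact: (measurableT_comp (measurable_noise u0)).
apply: measurable_funD; first apply: measurable_funD => //.
- apply: measurable_funM => //.
  by apply: (measurableT_comp _ IH); exact: continuous_measurable_fun.
- by apply: measurable_funB; apply: mB; rewrite mulr_ge0.
Qed.

(** An upper limit in place of a limit: it is measurable on the whole space,
including the null set where the scheme fails to converge. *)
Definition noise_flow (t : R) (z : R * noise_space) : R :=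
  fine (limn_esup (fun m =>
    (euler b (fun u => sigma * B u z.2) (t / m.+1%:R) z.1 m.+1)%:E)).

Lemma measurable_noise_flow (t : R) : 0 <= t ->
  measurable_fun setT (noise_flow t).
Proof.
move=> t0.
have mfine : measurable_fun setT (@fine R) by exact: fine_measurable.
apply: (measurableT_comp mfine).
apply: measurable_fun_limn_esup => m; apply: measurableT_comp => //.
by apply: measurable_euler; rewrite divr_ge0.
Qed.

Lemma noise_flowE (M : R) (f : R -> R) (x t : R) (w : T) :
  is_C2 b -> (forall x, `|derive1n 2 b x| <= M) ->
  path_solution b (fun u => sigma * B u w) f x -> f 0 = x -> 0 <= t ->
  noise_flow t (x, w) = f t.
Proof.
move=> b_C2 b_bnd fS f0 t0; rewrite /noise_flow /=.
have uc : (euler b (fun u => sigma * B u w) (t / m.+1%:R) x m.+1)%:E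
    @[m --> \oo] --> (f t)%:E.
  apply: cvg_EFin; first by apply: nearW.
  exact: (euler_cvg b_C2 b_bnd fS f0 t0).
rewrite is_cvg_limn_esupE; first by rewrite (cvg_lim _ uc).
by apply/cvg_ex; exists (f t)%:E.
Qed.

Section Law.
Variables (Y : {RV P >-> R}) (nu : probability R R).
Hypothesis Y_indep : independent_of P Y (sigma_of B `[0, +oo[).
Hypothesis Y_law : forall A : set R, measurable A -> distribution P Y A = nu A.

Lemma measurable_start_noise :
  measurable_fun setT (fun w : T => (Y w, w : noise_space)).
Proof.
apply: measurable_fun_pair; first exact: measurable_funP.
exact: measurable_noise_id.
Qed.

Local Open Scope ereal_scope.

(** Independence of the initial value and the noise identifies their joint law
on rectangles, hence everywhere. *)
Lemma start_noise_law (C : set (R * noise_space)) : measurable C ->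
  P ((fun w : T => (Y w, w : noise_space)) @^-1` C) = (nu \x noise_law) C.
Proof.
move=> mC.
rewrite (@product_measure_unique _ _ _ _ _ nu noise_law
  (image_law P measurable_start_noise))//.
move=> A E mA mE; transitivity (distribution P Y A * noise_law E).
  exact: Y_indep.
by congr (_ * _); exact: Y_law.
Qed.

Lemma solution_law (t : R) (Z : {RV P >-> R}) : (0 <= t)%R ->
  {ae P, forall w : T, noise_flow t (Y w, w) = Z w} ->
  forall A, measurable A ->
    distribution P Z A = (nu \x noise_law) (noise_flow t @^-1` A).
Proof.
move=> t0 FZ A mA.
have mF := measurable_noise_flow t0.
have mFA : measurable (noise_flow t @^-1` A).
  by rewrite -[X in measurable X]setTI; exact: mF.
rewrite -start_noise_law// /distribution /pushforward.
have mZA : measurable (Z @^-1` A).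
  by rewrite -[X in measurable X]setTI; exact: measurable_funP.
have mYA : measurable ((fun w : T => noise_flow t (Y w, w)) @^-1` A).
  rewrite -[X in measurable X]setTI.
  exact: (measurableT_comp mF measurable_start_noise).
apply: ae_eq_measure => //; apply: filterS FZ => w FZ.
by rewrite /preimage/= FZ.
Qed.

End Law.
End NoiseFlow.
Arguments noise_flow {d T R P} B b sigma t z.

(** * Equality of the two contraction coefficients *)

Section Coefficients.
Context {R : realType} {d : measure_display} {T : measurableType d}.
Variables (sigma : R) (b : R -> R) (L M : R).
Hypothesis b_C2 : is_C2 b.
Hypothesis b_bnd : forall x : R, `|derive1n 2 b x| <= M.
Hypothesis L_ge0 : 0 <= L.
Hypothesis b_lip : one_sided_lipschitz b L.
Variables (P : probability T R) (B : R -> {RV P >-> R}).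
Variable X : probability R R -> R -> {RV P >-> R}.
Hypothesis X_sol : forall nu : probability R R, finite_first_moment nu ->
  sde_solution b sigma B (X nu) /\ starts_from (X nu) nu.
Variable Phi : R -> R -> R -> {RV P >-> R}.
Hypothesis Phi_sol :
  forall x v : R, tangent_solution b (X (dirac x)) v (Phi x v).

Lemma dirac_finite_first_moment (x : R) : finite_first_moment (dirac x).
Proof.
rewrite /finite_first_moment integral_dirac//.
  by rewrite diracT mul1e ltry.
by apply: measurableT_comp.
Qed.

Lemma solution_path (nu : probability R R) : finite_first_moment nu ->
  {ae P, forall w, path_solution b (fun u => sigma * B u w)
    (fun s => X nu s w) (X nu 0 w)}.
Proof. by move=> /X_sol[[_ H] _]; apply: filterS H => w. Qed.

Lemma dirac_start (x : R) : {ae P, forall w, X (dirac x) 0 w = x}.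
Proof.
have [_ sf] := X_sol (dirac_finite_first_moment x).
have mx : measurable (~` [set x]) by exact: measurableC.
exists (X (dirac x) 0 @^-1` ~` [set x]); split => //.
- by rewrite -[X in measurable X]setTI; exact: measurable_funP.
- have := sf _ mx; rewrite /distribution /pushforward => ->.
  by apply: (eq_trans (diracE _ _ _)); rewrite memNset//= => /(_ erefl).
Qed.

Lemma dirac_path (x : R) : {ae P, forall w,
  path_solution b (fun u => sigma * B u w) (fun s => X (dirac x) s w) x /\
  X (dirac x) 0 w = x}.
Proof.
apply: filterS2 (dirac_start x) (solution_path (dirac_finite_first_moment x)).
by move=> w x0; rewrite x0.
Qed.

Lemma solution_flow (t : R) (nu : probability R R) : 0 <= t ->
  finite_first_moment nu ->
  {ae P, forall w : T, noise_flow B b sigma t (X nu 0 w, w) = X nu t w}.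
Proof.
move=> t0 /solution_path; apply: filterS => w pw.
exact: (@noise_flowE _ _ _ P B b sigma M (fun s => X nu s w)).
Qed.

Lemma dirac_flow (t x : R) : 0 <= t ->
  {ae P, forall w : T, noise_flow B b sigma t (x, w) = X (dirac x) t w}.
Proof.
move=> t0; apply: filterS (dirac_path x) => w [pw x0].
exact: (@noise_flowE _ _ _ P B b sigma M (fun s => X (dirac x) s w)).
Qed.

Variable t : R.
Hypothesis t0 : 0 <= t.

Lemma dirac_difference (x y v : R) : `|v| = 1 -> {ae P, forall w,
  `|x - y| * `|Phi y v t w| * expR (- tangent_error L M t `|x - y|)
    <= `|X (dirac x) t w - X (dirac y) t w| /\
  `|X (dirac x) t w - X (dirac y) t w|
    <= `|x - y| * `|Phi y v t w| * expR (tangent_error L M t `|x - y|)}.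
Proof.
move=> v1.
apply: filterS3 (dirac_path x) (dirac_path y) (Phi_sol y v) => w.
move=> [px _] [py _] pv.
exact: (path_difference_tangent b_C2 b_bnd b_lip L_ge0 px py pv v1 t0).
Qed.

Lemma dirac_order (x y : R) : y < x ->
  {ae P, forall w, X (dirac y) t w <= X (dirac x) t w}.
Proof.
move=> yx; apply: filterS2 (dirac_path x) (dirac_path y) => w [px _] [py _].
exact: (path_order b_C2 b_bnd b_lip L_ge0 px py t0 yx).
Qed.

Lemma tangent_bound (y v : R) : `|v| = 1 ->
  {ae P, forall w, `|Phi y v t w| <= expR (L * t)}.
Proof.
move=> v1; apply: filterS2 (dirac_path y) (Phi_sol y v) => w [py _] pv.
exact: (tangent_le b_C2 b_bnd b_lip py pv v1 t0).
Qed.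

Local Open Scope ereal_scope.

Let D x y := \int[P]_w `|X (dirac x) t w - X (dirac y) t w|%:E.
Let E y v := \int[P]_w `|Phi y v t w|%:E.

Lemma expected_difference_le (x y v : R) : (`|v| = 1)%R ->
  D x y <= (`|x - y| * expR (tangent_error L M t `|x - y|))%:E * E y v.
Proof.
move=> v1; have mN := measurable_norm_RV (Phi y v t).
rewrite -ge0_integralZl_EFin//.
apply: ae_ge0_le_integral => //; first exact: measurable_dist_RV.
- exact: measurable_funeM.
- apply: filterS (dirac_difference x y v1) => w [_ H] _.
  by rewrite -EFinM lee_fin mulrAC.
Qed.

Lemma expected_difference_ge (x y v : R) : (`|v| = 1)%R ->
  (`|x - y| * expR (- tangent_error L M t `|x - y|))%:E * E y v <= D x y.
Proof.
move=> v1; have mN := measurable_norm_RV (Phi y v t).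
rewrite -ge0_integralZl_EFin//.
apply: ae_ge0_le_integral => //; last 1 first.
- apply: filterS (dirac_difference x y v1) => w [H _] _.
  by rewrite -EFinM lee_fin mulrAC.
- exact: measurable_funeM.
- exact: measurable_dist_RV.
Qed.

Lemma expected_tangent_le (y v : R) : (`|v| = 1)%R ->
  E y v <= (expR (L * t))%:E.
Proof.
move=> v1; rewrite -(integral_probability_cst P).
apply: ae_ge0_le_integral => //; first exact: measurable_norm_RV.
by apply: filterS (tangent_bound y v1) => w H _; rewrite lee_fin.
Qed.

Lemma expected_difference_triangle (x y z : R) : D x z <= D x y + D y z.
Proof.
rewrite -ge0_integralD//; last 2 first.
- exact: measurable_dist_RV.
- exact: measurable_dist_RV.
apply: ge0_le_integral => //.
- exact: measurable_dist_RV.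
- by apply: emeasurable_funD; exact: measurable_dist_RV.
- by move=> w _; rewrite lee_fin ler_distD.
Qed.

Lemma kappa1_expectation (y v : R) : (v = -1 \/ v = 1)%R ->
  E y v <= kappa1 Phi t.
Proof.
move=> vE; apply: ereal_sup_ubound; exists y, v; split => //.
by rewrite unlock.
Qed.

Lemma kappa1_le (m : \bar R) :
  (forall y v, (v = -1 \/ v = 1)%R -> E y v <= m) -> kappa1 Phi t <= m.
Proof.
by move=> H; apply: ge_ereal_sup => _ [y [v [vE ->]]]; rewrite unlock; exact: H.
Qed.

Lemma unit_norm (v : R) : (v = -1 \/ v = 1)%R -> (`|v| = 1)%R.
Proof. by case=> ->; rewrite ?normrN normr1. Qed.

Lemma kappa1_ge0 : 0 <= kappa1 Phi t.
Proof.
apply: (@le_trans _ _ (E 0 1)); last by apply: kappa1_expectation; right.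
by apply: integral_ge0.
Qed.

Lemma kappa1_fin_num : kappa1 Phi t \is a fin_num.
Proof.
rewrite ge0_fin_numE ?kappa1_ge0//.
apply: (@le_lt_trans _ _ (expR (L * t))%:E); last exact: ltry.
by apply: kappa1_le => y v /unit_norm; exact: expected_tangent_le.
Qed.

Let k := fine (kappa1 Phi t).

Lemma expected_difference_steps (x h : R) (n : nat) :
  D (x + n%:R * h)%R x <=
    (n%:R * (`|h| * expR (tangent_error L M t `|h|) * k))%:E.
Proof.
have step y : D (y + h)%R y <=
    (`|h| * expR (tangent_error L M t `|h|) * k)%:E.
  apply: (le_trans (expected_difference_le _ _ (normr1 _))).
  rewrite addrC addKr [leRHS]EFinM /k fineK ?kappa1_fin_num//.
  apply: lee_wpmul2l; first by rewrite lee_fin mulr_ge0 ?expR_ge0.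
  by apply: kappa1_expectation; right.
elim: n => [|n IH].
  rewrite !mul0r addr0 /D (eq_integral (cst 0)) ?integral0//.
  by move=> w _; rewrite subrr normr0.
have -> : (x + n.+1%:R * h = x + n%:R * h + h)%R.
  by rewrite -addn1 natrD mulrDl mul1r addrA.
apply: (le_trans (expected_difference_triangle _ (x + n%:R * h)%R _)).
rewrite -[n.+1]add1n natrD mulrDl mul1r EFinD.
exact: (leeD (step _) IH).
Qed.

(** Over a step of length [delta] the estimate by [kappa1] loses a factor
[e^(C delta)]; summing over [n] equal steps from [y] to [x] loses only
[e^(C |x - y| / n)] in total, which tends to 1. *)
Lemma expected_difference_lipschitz (x y : R) : D x y <= (k * `|x - y|)%:E.
Proof.
have D0 : 0 <= D x y by apply: integral_ge0.
have bound n : D x y <=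
    (`|x - y| * expR (tangent_error L M t (`|x - y| / n.+1%:R)) * k)%:E.
  have n0 : (n.+1%:R : R) != 0%R by rewrite pnatr_eq0.
  have := expected_difference_steps y ((x - y) / n.+1%:R) n.+1.
  have -> : (y + n.+1%:R * ((x - y) / n.+1%:R))%R = x.
    by rewrite mulrC divfK// addrC subrK.
  move/le_trans; apply.
  rewrite lee_fin normrM normfV [`|n.+1%:R|%R]ger0_norm//.
  by rewrite !mulrA [(n.+1%:R * _)%R]mulrC mulfK.
have Dfin : D x y \is a fin_num.
  by rewrite ge0_fin_numE//; exact: (le_lt_trans (bound 0%N) (ltry _)).
rewrite -(fineK Dfin) lee_fin; apply: ler_expR_slack => e e0.
pose c := (M * `|x - y| * expR (L * t) * t)%R.
have M0 := bound_ge0 b_bnd.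
have c0 : (0 <= c)%R by rewrite !mulr_ge0 ?expR_ge0.
(* As c / n.+1 is the error of one step, this is enough steps to bring it
   below e. *)
pose n := Num.truncn (c / e).
have := bound n; rewrite -[leLHS](fineK Dfin) lee_fin => /le_trans; apply.
rewrite mulrAC [(`|x - y| * k)%R]mulrC.
rewrite ler_wpM2l ?mulr_ge0 ?fine_ge0 ?kappa1_ge0// ler_expR.
have -> : tangent_error L M t (`|x - y| / n.+1%:R)%R = (c / n.+1%:R)%R.
  by rewrite /tangent_error /c; ring.
rewrite ler_pdivrMr// mulrC -ler_pdivrMr//.
by apply: ltW; rewrite truncnS_gt.
Qed.

Lemma noise_flow_lipschitz (x y : R) :
  \int[noise_law B]_w
    `|noise_flow B b sigma t (x, w) - noise_flow B b sigma t (y, w)|%:E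
  <= (k * `|x - y|)%:E.
Proof.
have cb := drift_continuous b_C2.
have mF := @measurable_noise_flow _ _ _ P B b sigma cb t t0.
have mFx z : measurable_fun setT
    (fun w : noise_space B => noise_flow B b sigma t (z, w)).
  by apply: (measurableT_comp mF); exact: measurable_fun_pair.
have mdF : measurable_fun setT (fun w : noise_space B =>
    `|noise_flow B b sigma t (x, w) - noise_flow B b sigma t (y, w)|%:E).
  by apply: measurableT_comp => //; apply: measurableT_comp => //;
    exact: measurable_funB.
rewrite ge0_integral_image_law//.
apply: le_trans (expected_difference_lipschitz x y).
rewrite le_eqVlt; apply/orP; left; apply/eqP; apply: ae_eq_integral => //.
- exact: (measurableT_comp mdF (@measurable_noise_id _ _ _ P B)).
- exact: measurable_dist_RV.
- by apply: (filterS2 _ _ (dirac_flow x t0) (dirac_flow y t0)) => w -> ->.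
Qed.

Lemma beta1_le_kappa1 : beta1 X t <= kappa1 Phi t.
Proof.
apply: ge_ereal_sup => _ [nu [mu [fnu fmu _ ->]]].
have cb := drift_continuous b_C2.
rewrite -(fineK kappa1_fin_num).
have law rho : finite_first_moment rho -> forall A, measurable A ->
    distribution P (X rho t) A =
    (rho \x noise_law B) (noise_flow B b sigma t @^-1` A).
  move=> frho; have [[ind _] sf] := X_sol frho.
  exact: (solution_law cb ind sf t0 (solution_flow t0 frho)).
apply: (W1_flow_ratio (@measurable_noise_flow _ _ _ P B b sigma cb t t0) _
  noise_flow_lipschitz).
- by rewrite fine_ge0 ?kappa1_ge0.
- exact: law.
- exact: law.
Qed.

Lemma dirac_coupling (x y : R) : coupling (dirac x) (dirac y) (dirac (x, y)).
Proof.
move=> A mA; split.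
  apply: (eq_trans (diracE _ _ _)); apply/esym.
  apply: (eq_trans (diracE _ _ _)).
  by rewrite in_setX/= in_setT andbT.
apply: (eq_trans (diracE _ _ _)); apply/esym; apply: (eq_trans (diracE _ _ _)).
by rewrite in_setX/= in_setT.
Qed.

(** The lower bound is [W1_ge] for the initial values of the solutions, which
are almost surely equal to [x] and [y]. *)
Lemma W1_dirac (x y : R) : (y < x)%R -> W1 (dirac x) (dirac y) = (x - y)%:E.
Proof.
move=> yx; have xy0 : (0 <= x - y)%R by rewrite subr_ge0 ltW.
apply/le_anti/andP; split.
  apply: ereal_inf_lbound; exists (dirac (x, y)); first exact: dirac_coupling.
  rewrite integral_dirac//; last exact: measurable_dist.
  by rewrite diracT mul1e/= ger0_norm.
have [_ sx] := X_sol (dirac_finite_first_moment x).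
have [_ sy] := X_sol (dirac_finite_first_moment y).
apply: le_trans (W1_ge sx sy _); last first.
  apply: (filterS2 _ _ (dirac_start x) (dirac_start y)) => w -> ->.
  exact: ltW.
rewrite -(integral_probability_cst P).
apply: ae_ge0_le_integral => //; first exact: measurable_dist_RV.
apply: (filterS2 _ _ (dirac_start x) (dirac_start y)) => w -> -> _.
by rewrite lee_fin ler_norm.
Qed.

Lemma dirac_neq (x y : R) : (y < x)%R -> ~ same_measure (dirac x) (dirac y).
Proof.
move=> yx /(_ [set x] (measurable_set1 x)) H.
have : (1%R%:E : \bar R) = 0.
  transitivity (\d_x [set x] : \bar R).
    by apply/esym; apply: (eq_trans (diracE _ _ _)); rewrite mem_set.
  apply: (eq_trans H); apply: (eq_trans (diracE _ _ _)).
  by rewrite memNset//= => yxE; move: yx; rewrite yxE ltxx.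
by case=> /eqP; rewrite oner_eq0.
Qed.

(** The ratio for [dirac (y + h)] and [dirac y] is at least
[e^(- C h) E|Phi^y_t|]; then [h] tends to 0. *)
Lemma kappa1_le_beta1 : kappa1 Phi t <= beta1 X t.
Proof.
apply: kappa1_le => y v /unit_norm v1.
have E0 : 0 <= E y v by apply: integral_ge0.
have Efin : E y v \is a fin_num.
  rewrite ge0_fin_numE//.
  exact: le_lt_trans (expected_tangent_le _ v1) (ltry _).
set r := fine (E y v).
have r0 : (0 <= r)%R by rewrite fine_ge0.
have bound h : (0 < h)%R ->
    (expR (- tangent_error L M t h) * r)%:E <= beta1 X t.
  move=> h0; have yh : (y < y + h)%R by rewrite ltrDl.
  apply: (@le_trans _ _ (W1 (distribution P (X (dirac (y + h)%R) t))
    (distribution P (X (dirac y) t)) / W1 (dirac (y + h)%R) (dirac y))).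
    rewrite W1_dirac// addrAC subrr add0r inver gt_eqF// lee_pdivlMr//.
    apply: le_trans (W1_ge (fun _ _ => erefl) (fun _ _ => erefl)
      (dirac_order yh)).
    apply: le_trans (expected_difference_ge _ _ v1).
    rewrite addrAC subrr add0r gtr0_norm// -(fineK Efin) -!EFinM lee_fin.
    by rewrite -/r mulrC mulrA.
  apply: ereal_sup_ubound; exists (dirac (y + h)%R), (dirac y); split => //.
  - exact: dirac_finite_first_moment.
  - exact: dirac_finite_first_moment.
  - exact: dirac_neq.
rewrite -(fineK Efin) -/r.
case Eb : (beta1 X t) => [K||]; last 2 first.
- by rewrite leey.
- by have := bound _ ltr01; rewrite Eb.
rewrite lee_fin; apply: ler_expR_slack => e e0.
pose c := (M * expR (L * t) * t)%R.
have M0 := bound_ge0 b_bnd.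
have c0 : (0 <= c)%R by rewrite !mulr_ge0 ?expR_ge0.
have c1 : (0 < c + 1)%R by rewrite ltr_wpDl.
have h0 : (0 < e / (c + 1))%R by rewrite divr_gt0.
have := bound _ h0; rewrite Eb lee_fin.
set te := tangent_error _ _ _ _ => rK.
have te_le : (te <= e)%R.
  have -> : te = (c / (c + 1) * e)%R.
    by rewrite /te /tangent_error /c; ring.
  by rewrite ler_piMl ?(ltW e0)// ler_pdivrMr// mul1r lerDl.
have K0 : (0 <= K)%R by apply: le_trans rK; rewrite mulr_ge0 ?expR_ge0.
apply: (@le_trans _ _ (K * expR te)%R); last by rewrite ler_wpM2l// ler_expR.
by rewrite -ler_pdivrMr ?expR_gt0// mulrC -expRN.
Qed.

End Coefficients.

Unset Implicit Arguments.
Set Strict Implicit.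

Theorem proposition2 (R : realType)
  (sigma : R) (b : R -> R)
  (b_C2 : is_C2 b)
  (b_bnd : exists M : R, forall x : R, `|derive1n 2 b x| <= M)
  (b_lip : exists L : R, 0 < L /\ one_sided_lipschitz b L)
  (d : measure_display) (T : measurableType d) (P : probability T R)
  (B : R -> {RV P >-> R})
  (B_bm : brownian_motion B)
  (X : probability R R -> R -> {RV P >-> R})
  (X_sol : forall nu : probability R R, finite_first_moment nu ->
     sde_solution b sigma B (X nu) /\ starts_from (X nu) nu)
  (Phi : R -> R -> R -> {RV P >-> R})
  (Phi_sol : forall x v : R, tangent_solution b (X (dirac x)) v (Phi x v)) :
  forall t : R, 0 <= t -> kappa1 Phi t = beta1 X t.
Proof.
move=> t t0.
have [M bM] := b_bnd; have [L [L0 bL]] := b_lip.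
apply/le_anti/andP; split.
- exact: (kappa1_le_beta1 b_C2 bM (ltW L0) bL X_sol Phi_sol t0).
- exact: (beta1_le_kappa1 b_C2 bM (ltW L0) bL X_sol Phi_sol t0).
Qed.
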